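(* Let $p$ be an odd prime and let $R_p$ be the dihedral quandle on $\mathbb{Z}_p$. Then the fourth quandle homology group $H^Q_4(R_p)$ contains $\mathbb{Z}_p$, i.e. it has a subgroup isomorphic to $\mathbb{Z}_p$.
   Context: $\mathbb{Z}_k=\mathbb{Z}/k\mathbb{Z}$. The dihedral quandle $R_k$ is the set $\mathbb{Z}_k$ with the operation $a*b=2b-a$. A quandle is a set $X$ with a binary operation $*$ such that $a*a=a$ for all $a$, for every $b$ the map $a\mapsto a*b$ is a bijection, and $(a*b)*c=(a*c)*(b*c)$ for all $a,b,c$. For $n\ge 1$, $C_n^R(X)$ is the free abelian group generated by $n$-tuples $(x_1,\dots,x_n)$ of elements of $X$, with boundary homomorphism $\partial: C^R_n(X)\to C^R_{n-1}(X)$, $$\partial(x_1,\ldots,x_n)=\sum_{i=2}^n(-1)^i\big((x_1,\ldots,x_{i-1},x_{i+1},\ldots,x_n)-(x_1*x_i,\ldots,x_{i-1}*x_i,x_{i+1},\ldots,x_n)\big)$$ (so $\partial=0$ on $C_1^R(X)$). The degenerate subcomplex $C^D_n(X)\subset C^R_n(X)$ is generated by the $n$-tuples with $x_{i+1}=x_i$ for some $i$. The quandle chain complex is $C^Q_n(X)=C^R_n(X)/C^D_n(X)$ with the induced boundary, and $H^Q_n(X)$ is its homology. *)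

(* Defs.v *)
From HB Require Import structures.
From mathcomp Require Import freeg.
From mathcomp Require Import all_boot all_order all_algebra.
From mathcomp Require Import ring_quotient.
From mathcomp Require Import boolp.
From mathcomp Require Import zify ring.

Set Implicit Arguments.
Unset Strict Implicit.
Unset Printing Implicit Defensive.

Import GRing.Theory.
Local Open Scope ring_scope.

HB.mixin Record isQuandle X of Choice X := {
  qop : X -> X -> X;
  qop_idem : forall a, qop a a = a;
  qop_bij : forall b, bijective (qop^~ b);
  qop_dist : forall a b c, qop (qop a b) c = qop (qop a c) (qop b c)
}.

#[short(type="quandleType")]
HB.structure Definition Quandle := {X of isQuandle X & Choice X}.

(* ['Z_k] is the ring of integers mod k only for [1 < k]. *)
Definition dihedral (k : nat) : Type := 'Z_k.

Section Dihedral.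
Variable k : nat.

HB.instance Definition _ := Choice.copy (dihedral k) 'Z_k.

Definition dihedral_op (a b : dihedral k) : dihedral k :=
  (b : 'Z_k) *+ 2 - (a : 'Z_k).

Fact dihedral_idem a : dihedral_op a a = a.
Proof. by rewrite /dihedral_op mulr2n addrK. Qed.

Fact dihedral_opK b : involutive (dihedral_op^~ b).
Proof. by move=> a; rewrite /dihedral_op opprB addrC subrK. Qed.

Fact dihedral_bij b : bijective (dihedral_op^~ b).
Proof. exact: inv_bij (dihedral_opK b). Qed.

Fact dihedral_dist a b c :
  dihedral_op (dihedral_op a b) c =
  dihedral_op (dihedral_op a c) (dihedral_op b c).
Proof.
by rewrite /dihedral_op; ring.
Qed.

HB.instance Definition _ := isQuandle.Build (dihedral k)
  dihedral_idem dihedral_bij dihedral_dist.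
End Dihedral.

(* The subgroup generated by S, as the intersection of all subgroups
   containing S. *)
Section GeneratedSubgroup.
Variables (G : zmodType) (S : G -> Prop).

Definition generated : {pred G} := fun x =>
  `[< forall H : {pred G}, zmod_closed H -> (forall s, S s -> s \in H) ->
      x \in H >].

Fact generated_zmod_closed : zmod_closed generated.
Proof.
split; first by apply/asboolP => H [].
move=> x y /asboolP xS /asboolP yS; apply/asboolP => H HS SH.
by case: (HS) => _; apply; [apply: xS | apply: yS].
Qed.

HB.instance Definition _ := GRing.isZmodClosed.Build G generated
  generated_zmod_closed.

Lemma mem_generated s : S s -> s \in generated.
Proof. by move=> Ss; apply/asboolP => H _; apply. Qed.

Lemma generated_min (H : zmodClosed G) :
  (forall s, S s -> s \in H) -> {subset generated <= H}.
Proof.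
by move=> SH x /asboolP; apply => //; split; [exact: rpred0|exact: rpredB].
Qed.
End GeneratedSubgroup.

Section Homology.
Variables (A B C : zmodType) (f : {additive A -> B}) (g : {additive B -> C}).

Definition cycle_pred : {pred B} := fun b => g b == 0.

Fact cycle_zmod_closed : zmod_closed cycle_pred.
Proof.
split=> [|x y]; rewrite !unfold_in ?raddf0 // raddfB.
by move=> /eqP-> /eqP->; rewrite subrr.
Qed.

HB.instance Definition _ := GRing.isZmodClosed.Build B cycle_pred
  cycle_zmod_closed.

Definition cycles : Type := {b : B | b \in cycle_pred}.
HB.instance Definition _ := SubChoice.on cycles.
HB.instance Definition _ := [SubChoice_isSubZmodule of cycles by <:].

(* As a subset of [cycles]; no proof of [g \o f = 0] is needed to form it. *)
Definition boundaries : {pred cycles} := fun z => `[< exists a, val z = f a >].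

Fact boundaries_zmod_closed : zmod_closed boundaries.
Proof.
split=> [|x y]; first by apply/asboolP; exists 0; rewrite !raddf0.
move=> /asboolP[a xa] /asboolP[b yb]; apply/asboolP; exists (a - b).
by rewrite raddfB -xa -yb raddfB.
Qed.

HB.instance Definition _ := GRing.isZmodClosed.Build cycles boundaries
  boundaries_zmod_closed.

Definition homology : zmodType := Quotient.quot boundaries.
End Homology.

Section QuandleHomology.
Variable X : quandleType.

Definition rack_chain (n : nat) : zmodType := {freeg (n.-tuple X) / int}.

Section Boundary.
Variable n : nat.
Implicit Type x : n.-tuple X.

Definition face0 (i : 'I_n) x : n.-1.-tuple X :=
  [tuple tnth x (lift i j) | j < n.-1].

Definition face1 (i : 'I_n) x : n.-1.-tuple X :=
  [tuple if (lift i j < i)%N then qop (tnth x (lift i j)) (tnth x i)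
         else tnth x (lift i j) | j < n.-1].

(* Indices start at 0, so that the i-th entry is x_(i+1); whence the sign and
   the condition 0 < i. *)
Definition boundary_gen x : {freeg (n.-1.-tuple X) / int} :=
  \sum_(i < n | (0 < i)%N)
    (-1) ^+ i.+1 *: (<< face0 i x >> - << face1 i x >>).

Definition rack_boundary : rack_chain n -> rack_chain n.-1 :=
  fglift boundary_gen.

Definition degenerate x : bool :=
  [exists i : 'I_n, exists j : 'I_n,
    (j == i.+1 :> nat) && (tnth x j == tnth x i)].

Definition degenerate_chain : {pred rack_chain n} :=
  generated (fun c : rack_chain n => exists2 x, degenerate x & c = << x >>).
HB.instance Definition _ := GRing.ZmodClosed.on degenerate_chain.

Definition quandle_chain : zmodType := Quotient.quot degenerate_chain.
End Boundary.

Fact rack_boundary_additive n : zmod_morphism (@rack_boundary n).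
Proof. exact: lift_is_additive. Qed.
HB.instance Definition _ n := GRing.isZmodMorphism.Build
  (rack_chain n) (rack_chain n.-1) (@rack_boundary n)
  (@rack_boundary_additive n).

Lemma rack_boundaryE n (x : n.-tuple X) :
  rack_boundary << x >> = boundary_gen x.
Proof. by rewrite /rack_boundary liftU scale1r. Qed.

Lemma degenerateP n (x : n.-tuple X) (i j : 'I_n) :
  j = i.+1 :> nat -> tnth x j = tnth x i -> degenerate x.
Proof.
move=> ji xji; apply/existsP; exists i; apply/existsP; exists j.
by rewrite ji xji !eqxx.
Qed.

Lemma degenerate_face n (x : n.-tuple X) (h i j : 'I_n) :
    j = i.+1 :> nat -> tnth x j = tnth x i -> h != i -> h != j ->
  degenerate (face0 h x) && degenerate (face1 h x).
Proof.
move=> ji xji /unlift_some[a ia _] /unlift_some[b jb _].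
have ba : b = a.+1 :> nat.
  move: ji; rewrite ia jb /= /bump.
  by case: (leqP h a); case: (leqP h b) => /=; lia.
have ltE : (lift h b < h)%N = (lift h a < h)%N.
  have := neq_lift h b; have := neq_lift h a.
  rewrite -!val_eqE -ia -jb ji /=; lia.
apply/andP; split; apply: (degenerateP ba);
  by rewrite !tnth_mktuple ?ltE -ia -jb xji.
Qed.

Lemma face_degenerate n (x : n.-tuple X) (i j : 'I_n) :
    j = i.+1 :> nat -> tnth x j = tnth x i ->
  face0 i x = face0 j x /\ face1 i x = face1 j x.
Proof.
move=> ji xji; have liftE (k : 'I_n.-1) :
    lift i k = lift j k \/ lift i k = j /\ lift j k = i.
  case: (ltngtP k i) => ki.
  - by left; apply: val_inj; rewrite /= /bump ji; lia.
  - by left; apply: val_inj; rewrite /= /bump ji; lia.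
  - by right; split; apply: val_inj; rewrite /= /bump ji ki; lia.
split; apply: eq_from_tnth => k; rewrite !tnth_mktuple.
- by case: (liftE k) => [->|[-> ->]].
- case: (liftE k) => [e|[-> ->]]; last first.
    by rewrite ji ltnSn ltnNge leqnSn /= xji qop_idem.
  have -> : (lift i k < i)%N = (lift j k < j)%N.
    have := neq_lift i k; have := neq_lift j k.
    by rewrite -!val_eqE e ji /=; lia.
  by rewrite e xji.
Qed.

Lemma rack_boundary_degenerate n (c : rack_chain n) :
  c \in @degenerate_chain n -> rack_boundary c \in @degenerate_chain n.-1.
Proof.
move=> /asboolP cD.
pose H : {pred rack_chain n} :=
  fun d => rack_boundary d \in @degenerate_chain n.-1.
have inH d : (d \in H) = (rack_boundary d \in @degenerate_chain n.-1) by [].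
rewrite -inH; apply: cD.
  split=> [|a b]; first by rewrite inH raddf0 rpred0.
  by rewrite !inH raddfB; exact: rpredB.
move=> _ [x /existsP[i /existsP[j /andP[/eqP ji /eqP xji]]] ->].
rewrite inH rack_boundaryE /boundary_gen.
have [f0 f1] := face_degenerate ji xji.
pose T (h : 'I_n) := (-1) ^+ h.+1 *: (<< face0 h x >> - << face1 h x >>)
  : {freeg (n.-1.-tuple X) / int}.
have T0 (h : 'I_n) : ~~ (0 < h)%N -> T h = 0.
  rewrite -eqn0Ngt => /eqP h0; rewrite /T; suff -> : face0 h x = face1 h x.
    by rewrite subrr scaler0.
  by apply: eq_from_tnth => k; rewrite !tnth_mktuple h0.
rewrite (_ : \sum_(_ < n | _) _ = \sum_(h < n) T h); last first.
  rewrite [RHS](bigID (fun h : 'I_n => 0 < h)%N) /=.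
  by rewrite [X in _ + X]big1 ?addr0.
have ij : j != i by rewrite -val_eqE /= ji; lia.
have Tij : T i + T j = 0.
  by rewrite /T f0 f1 ji [_ ^+ i.+2]exprS mulN1r scaleNr subrr.
rewrite (bigD1 i) // (bigD1 j) //= addrA Tij add0r.
apply: (@rpred_sum _ (@degenerate_chain n.-1)) => h /andP[hi hj].
have /andP[D0 D1] := degenerate_face ji xji hi hj.
have D : (<< face0 h x >> - << face1 h x >> : rack_chain n.-1)
    \in @degenerate_chain n.-1.
  by apply: rpredB; apply: mem_generated; [exists (face0 h x) | exists (face1 h x)].
by rewrite /T -signr_odd; case: odd; rewrite ?scaleN1r ?scale1r // rpredN.
Qed.

Definition quandle_boundary n (c : quandle_chain n) : quandle_chain n.-1 :=
  \pi_(quandle_chain n.-1)%qT (rack_boundary (repr c)).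

Lemma quandle_boundary_pi n (c : rack_chain n) :
  quandle_boundary (\pi_(quandle_chain n)%qT c) =
  \pi_(quandle_chain n.-1)%qT (rack_boundary c).
Proof.
apply/eqP; rewrite -Quotient.idealrBE -raddfB.
by apply: rack_boundary_degenerate; rewrite Quotient.idealrBE reprK.
Qed.

Fact quandle_boundary_additive n : zmod_morphism (@quandle_boundary n).
Proof.
move=> a b; rewrite -[a]reprK -[b]reprK -raddfB !quandle_boundary_pi.
by rewrite -!raddfB.
Qed.

HB.instance Definition _ n := GRing.isZmodMorphism.Build
  (quandle_chain n) (quandle_chain n.-1) (@quandle_boundary n)
  (@quandle_boundary_additive n).

Definition quandle_homology (n : nat) : zmodType :=
  homology (@quandle_boundary n.+1) (@quandle_boundary n).

End QuandleHomology.

Definition has_subgroup_isomorphic_to (A G : zmodType) : Prop :=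
  exists (S : zmodClosed G) (f : {additive A -> G}),
    injective f /\ (forall y, y \in S <-> exists x, y = f x).

(* Main.v *)
(** For u in Z_p let s_u be the formal sum of the pairs (j, j + u), j in Z_p. The sum
    telescopes, so an s_u inserted at two consecutive places of a tuple contributes no
    face at those places; consequently z = (0, 1, s_1) - (0, s_1, 0) + (2, s_1, 1) is
    a cycle. In the cokernel of the boundary,
    z = (2e, 2e-1, s_{-1}) - (2e, s_{-1}, 2e) + (2e-2, s_{-1}, 2e-1) for every e, so
    p z is a combination of the diagonal sums C_k = sum_t (t, t+k, s_{-1}) and
    A_k = sum_t (t, s_{-1}, t+k). The boundaries of (t, t+k, t+l, s_u) and
    (t, s_u, t+k, t+l), summed over t and then l, give p C_k = 0 and
    p A_k = p A_0; hence p^2 z = 0 in homology.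
    On the other hand z is detected mod p by the 4-cocycle
    f(a, b, c, d) = (a - b) g(b - c, c - d), g(u, v) = (2 h(v) - h(u+v) - h(v-u)) / p,
    where h is an odd lift to the integers of multiplication by 2, since f(z) = 4.
    So z is nonzero of order p or p^2, and z or p z generates a copy of Z_p. *)
From HB Require Import structures.
Require Import Defs.
From mathcomp Require Import freeg.
From mathcomp Require Import all_boot all_order all_algebra.
From mathcomp Require Import ring_quotient.
From mathcomp Require Import boolp.
From mathcomp Require Import zify ring.

Set Implicit Arguments.
Unset Strict Implicit.
Unset Printing Implicit Defensive.

Import GRing.Theory.
Local Open Scope ring_scope.

(** * Cokernels, and cyclic subgroups of order [p] *)

Lemma quot_pi_eq0 (G : zmodType) (H : zmodClosed G) (x : G) :
  (\pi_(Quotient.quot H)%qT x == 0) = (x \in H).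
Proof. by rewrite -[x in RHS]subr0 Quotient.idealrBE raddf0. Qed.

Section Cokernel.
Variables (A B : zmodType) (f : {additive A -> B}).

Definition image_pred : {pred B} := fun b => `[< exists a, b = f a >].

Fact image_zmod_closed : zmod_closed image_pred.
Proof.
split=> [|_ _ /asboolP[a ->] /asboolP[b ->]]; apply/asboolP.
  by exists 0; rewrite raddf0.
by exists (a - b); rewrite raddfB.
Qed.

HB.instance Definition _ :=
  GRing.isZmodClosed.Build B image_pred image_zmod_closed.

Definition cokernel : zmodType := Quotient.quot image_pred.

Lemma cokernel_pi_eq0 b : \pi_cokernel%qT b = 0 <-> exists a, b = f a.
Proof.
split=> [/eqP|] H; first by move: H; rewrite quot_pi_eq0 => /asboolP.
by apply/eqP; rewrite quot_pi_eq0; apply/asboolP.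
Qed.
End Cokernel.

Lemma torsion_element (G : zmodType) (p : nat) (x : G) :
  x != 0 -> x *+ (p * p) = 0 -> exists2 y : G, y != 0 & y *+ p = 0.
Proof.
move=> x0 xpp; have [xp|xp] := eqVneq (x *+ p) 0; first by exists x.
by exists (x *+ p); rewrite // -mulrnA.
Qed.

Section CyclicSubgroup.
Variables (G : zmodType) (p : nat) (x : G).
Hypotheses (p_prime : prime p) (x_neq0 : x != 0) (xp0 : x *+ p = 0).

Definition Zp_multiple (k : 'Z_p) : G := x *+ k.

Lemma mulrn_modp n : x *+ (n %% (Zp_trunc p).+2) = x *+ n.
Proof.
rewrite Zp_cast ?prime_gt1 //.
by rewrite [in RHS](divn_eq n p) mulrnDr mulnC mulrnA xp0 mul0rn add0r.
Qed.

Lemma Zp_multiple_additive : zmod_morphism Zp_multiple.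
Proof.
move=> a b; apply/eqP; rewrite eq_sym subr_eq -mulrnDr -[eqbRHS]mulrn_modp.
by rewrite -[X in Zp_multiple X](subrK b a).
Qed.

HB.instance Definition _ :=
  GRing.isZmodMorphism.Build 'Z_p G Zp_multiple Zp_multiple_additive.

Lemma Zp_multiple_inj : injective Zp_multiple.
Proof.
apply: raddf_inj => k xk0; apply/eqP; rewrite -val_eqE /= -leqn0 leqNgt.
apply/negP => k_gt0; have := ltn_ord k.
rewrite [X in (_ < X)%N]Zp_cast ?prime_gt1 // => kp.
have /eqP co : coprime k p by rewrite coprime_sym prime_coprime // gtnNdvd.
(* Bezout gives [u * k = v * p + 1], so [x] would be a combination of [x *+ k] and [x *+ p], both
   zero. *)
have [u v e _] := egcdnP p k_gt0.
move/eqP: x_neq0; apply; rewrite -[x]mulr1n -co.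
have xk : x *+ k = 0 := xk0.
have := congr1 (fun n => x *+ n) e.
by rewrite /= mulrnDr !(mulnC _ k, mulnC _ p) !mulrnA xk xp0 !mul0rn add0r.
Qed.

Lemma Zp_subgroup : has_subgroup_isomorphic_to 'Z_p G.
Proof.
exists (GRing.ZmodClosed.clone G (image_pred Zp_multiple) _).
exists (GRing.Additive.clone _ _ Zp_multiple _).
split=> [|y]; first exact: Zp_multiple_inj.
by split=> /asboolP.
Qed.
End CyclicSubgroup.

(** * Explicit rack boundaries of 4-tuples and 5-tuples *)

Section Chains.
Variable X : quandleType.
Implicit Types a b c d e : X.

Definition gen3 a b c : rack_chain X 3 := << [tuple a; b; c] >>.
Definition gen4 a b c d : rack_chain X 4 := << [tuple a; b; c; d] >>.
Definition gen5 a b c d e : rack_chain X 5 := << [tuple a; b; c; d; e] >>.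

Lemma rack_boundary4 a b c d :
  rack_boundary (gen4 a b c d) =
    gen3 a c d - gen3 (qop a b) c d
    - (gen3 a b d - gen3 (qop a c) (qop b c) d)
    + (gen3 a b c - gen3 (qop a d) (qop b d) (qop c d)).
Proof.
rewrite /gen4 rack_boundaryE /boundary_gen big_mkcond !big_ord_recl big_ord0 /=.
rewrite add0r addr0 !exprS expr0 !mulrN1 !opprK !mulr1 !scale1r scaleN1r addrA.
congr (_ - _ - (_ - _) + (_ - _)); congr << _ >>; apply: eq_from_tnth => -[[|[|[|//]]] ?];
  by rewrite tnth_mktuple.
Qed.

Lemma rack_boundary5 a b c d e :
  rack_boundary (gen5 a b c d e) =
    gen4 a c d e - gen4 (qop a b) c d e
    - (gen4 a b d e - gen4 (qop a c) (qop b c) d e)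
    + (gen4 a b c e - gen4 (qop a d) (qop b d) (qop c d) e)
    - (gen4 a b c d - gen4 (qop a e) (qop b e) (qop c e) (qop d e)).
Proof.
rewrite /gen5 rack_boundaryE /boundary_gen big_mkcond !big_ord_recl big_ord0 /=.
rewrite add0r addr0 !exprS expr0 !mulrN1 !opprK !mulr1 !scale1r !scaleN1r addrA addrA.
congr (_ - _ - (_ - _) + (_ - _) - (_ - _)); congr << _ >>;
  by apply: eq_from_tnth => -[[|[|[|[|//]]]] ?]; rewrite tnth_mktuple.
Qed.
End Chains.

(** * Coboundaries summed over an inserted pair [(j, j + u)] *)

Section DihedralSums.
Variables (R : finComNzRingType) (V : zmodType).
Implicit Types (a b c d e j k l t u : R) (T : R -> R -> R -> V).
Implicit Types (F : R -> R -> R -> R -> V) (g : R -> R -> V).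

Let inv a b : R := b *+ 2 - a.

(** The additive extension of [T], evaluated at the boundary of [(a, b, c, d)]. The target [V] is
    arbitrary here and in [coboundary4], so that one identity serves for basis tuples, for classes
    modulo boundaries and for ['Z_p]-valued cochains. *)
Definition coboundary3 T a b c d : V :=
  T a c d - T (inv a b) c d - (T a b d - T (inv a c) (inv b c) d)
  + (T a b c - T (inv a d) (inv b d) (inv c d)).

Definition coboundary4 F a b c d e : V :=
  F a c d e - F (inv a b) c d e
  - (F a b d e - F (inv a c) (inv b c) d e)
  + (F a b c e - F (inv a d) (inv b d) (inv c d) e)
  - (F a b c d - F (inv a e) (inv b e) (inv c e) (inv d e)).

(* [(0, 1, s) - (0, s, 0) + (2, s, 1)] with [s = sum_j (j, j + 1)]. *)
Definition special_cycle F : V :=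
  \sum_j F 0 1 j (j + 1) - \sum_j F 0 j (j + 1) 0 + \sum_j F 2 j (j + 1) 1.

Lemma sum_shift (f : R -> V) u : \sum_j f (j + u) = \sum_j f j.
Proof. by rewrite [RHS](reindex_inj (addIr u)). Qed.

Lemma sum_reflect (f : R -> V) e : \sum_j f (e - j) = \sum_j f j.
Proof. by rewrite [RHS](reindex_inj (subrI e)). Qed.

Lemma sum_shift2 g k l :
  \sum_t g (t + k) (t + l) = \sum_t g t (t + (l - k)).
Proof.
rewrite -[RHS](sum_shift _ k); apply: eq_bigr => t _.
by congr g; ring.
Qed.

Lemma sum_inv g k l :
  \sum_t g (inv t (t + k)) (t + l) = \sum_t g t (t + (l - k *+ 2)).
Proof.
rewrite -(sum_shift2 g (k *+ 2) l); apply: eq_bigr => t _.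
by congr g; rewrite /inv; ring.
Qed.

Lemma sum_inv2 g k l :
  \sum_t g (inv t (t + l)) (inv (t + k) (t + l)) = \sum_t g t (t + - k).
Proof.
rewrite -[RHS](sum_shift _ (l *+ 2)); apply: eq_bigr => t _.
by congr g; rewrite /inv; ring.
Qed.

Lemma inv_pair j u : inv j (j + u) = (j + u) + u.
Proof. by rewrite /inv; ring. Qed.

Lemma inv_shift a j u : inv (j + u) a = inv j a - u.
Proof. by rewrite /inv; ring. Qed.

Definition insert_pair3 T a u : V := \sum_j T a j (j + u).

(** The faces at the two inserted entries cancel after a shift of [j] by [u], because
    [inv j (j + u)] is [j + u + u]; the face at [b] remains. *)
Lemma sum_coboundary3_last T a b u :
  \sum_j coboundary3 T a b j (j + u) = insert_pair3 T a u - insert_pair3 T (inv a b) u.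
Proof.
rewrite /coboundary3 !(sumrB, big_split) /=.
rewrite (sum_shift (fun j => T a b j) u).
rewrite -(sum_shift (fun j => T (inv a j) (inv b j) (j + u)) u) /=.
under [X in _ - _ - _ + (_ - X)]eq_bigr do rewrite inv_pair.
by rewrite subrK.
Qed.

(** The faces inside the pair cancel again. Acting by [b] reflects the pair to [(i, i - u)] with
    [i = inv j b], whence the [- u]. *)
Lemma sum_coboundary3_mid T a b u :
  \sum_j coboundary3 T a j (j + u) b =
  insert_pair3 T a u - insert_pair3 T (inv a b) (- u).
Proof.
rewrite /coboundary3 !(sumrB, big_split) /=.
rewrite (sum_shift (fun j => T a j b) u).
rewrite -(sum_shift (fun j => T (inv a j) (j + u) b) u) /=.
under [X in _ - _ - (_ - X)]eq_bigr do rewrite inv_pair.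
rewrite subrr add0r; congr (_ - _).
rewrite /insert_pair3 -(sum_reflect _ (b *+ 2)); apply: eq_bigr => j _.
by rewrite inv_shift.
Qed.

(** Write P_a(u) for [insert_pair3 T a u]. The three sums are P_0(1) - P_2(1), P_0(1) - P_0(-1) and
    P_2(1) - P_0(-1); the first minus the second plus the third is 0. *)
Lemma special_cycle_coboundary3 T : special_cycle (coboundary3 T) = 0.
Proof.
rewrite /special_cycle sum_coboundary3_last !sum_coboundary3_mid /inv.
by rewrite mul0rn !subr0 subrr opprB (addrC (_ - _) (_ - _)) !subrKA subrr.
Qed.

(* The values of [F] at [(a, b, s_u)] and [(a, s_u, b)], where
   [s_u = sum_j (j, j + u)]. *)
Definition insert_last F a b u : V := \sum_j F a b j (j + u).
Definition insert_mid F a b u : V := \sum_j F a j (j + u) b.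

(** The suffix shows where s_u sits in the 5-tuple. In this lemma and the next two, the faces inside
    the pair cancel, and acting by an entry to its right turns s_u into s_{-u}. *)
Lemma sum_coboundary4_abse F a b e u :
  \sum_j coboundary4 F a b j (j + u) e =
  insert_mid F a e u - insert_mid F (inv a b) e u
  - (insert_last F a b u - insert_last F (inv a e) (inv b e) (- u)).
Proof.
rewrite /coboundary4 !(sumrB, big_split) /=.
rewrite (sum_shift (fun j => F a b j e) u).
rewrite -(sum_shift (fun j => F (inv a j) (inv b j) (j + u) e) u) /=.
under [X in _ - _ - _ + (_ - X)]eq_bigr do rewrite inv_pair.
rewrite subrK; congr (_ - _ - (_ - _)).
rewrite /insert_last -(sum_reflect _ (e *+ 2)); apply: eq_bigr => j _.
by rewrite inv_shift.
Qed.

Lemma sum_coboundary4_asde F a d e u :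
  \sum_j coboundary4 F a j (j + u) d e =
  insert_mid F a e u - insert_mid F (inv a d) e (- u)
  - (insert_mid F a d u - insert_mid F (inv a e) (inv d e) (- u)).
Proof.
rewrite /coboundary4 !(sumrB, big_split) /=.
rewrite (sum_shift (fun j => F a j d e) u).
rewrite -(sum_shift (fun j => F (inv a j) (j + u) d e) u) /=.
under [X in _ - _ - (_ - X)]eq_bigr do rewrite inv_pair.
rewrite subrr add0r; congr (_ - _ - (_ - _)).
  rewrite /insert_mid -(sum_reflect _ (d *+ 2)); apply: eq_bigr => j _.
  by rewrite inv_shift.
rewrite /insert_mid -(sum_reflect _ (e *+ 2)); apply: eq_bigr => j _.
by rewrite inv_shift.
Qed.

Lemma sum_coboundary4_abcs F a b c u :
  \sum_j coboundary4 F a b c j (j + u) =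
  insert_last F a c u - insert_last F (inv a b) c u
  - (insert_last F a b u - insert_last F (inv a c) (inv b c) u).
Proof.
rewrite /coboundary4 !(sumrB, big_split) /=.
rewrite (sum_shift (fun j => F a b c j) u).
rewrite -(sum_shift (fun j => F (inv a j) (inv b j) (inv c j) (j + u)) u) /=.
under [X in _ - _ - _ + _ - (_ - X)]eq_bigr do rewrite inv_pair.
by rewrite addrK.
Qed.

(** * Torsion of the special cycle modulo boundaries *)

Section Torsion.
Variable F : R -> R -> R -> R -> V.
Hypothesis F_cocycle : forall a b c d e, coboundary4 F a b c d e = 0.
Hypothesis F_degenerate : forall a c d, F a a c d = 0.
Variable half : R.
Hypothesis half2 : half *+ 2 = 1.

Let L := insert_last F.
Let M := insert_mid F.

Lemma cocycle_abse a b e u :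
  M a e u - M (inv a b) e u = L a b u - L (inv a e) (inv b e) (- u).
Proof. by apply/subr0_eq; rewrite -sum_coboundary4_abse big1. Qed.

Lemma cocycle_asde a d e u :
  M a e u - M (inv a d) e (- u) = M a d u - M (inv a e) (inv d e) (- u).
Proof. by apply/subr0_eq; rewrite -sum_coboundary4_asde big1. Qed.

Lemma cocycle_abcs a b c u :
  L a c u - L (inv a b) c u = L a b u - L (inv a c) (inv b c) u.
Proof. by apply/subr0_eq; rewrite -sum_coboundary4_abcs big1. Qed.

Let C u k : V := \sum_t L t (t + k) u.
Let A u k : V := \sum_t M t (t + k) u.

(** This is [cocycle_abcs] at [(t, t + k, t + l)], summed over [t]. The right side is independent of
    [l], so summing over [l] makes the left side telescope. *)
Lemma C_relation u k l : C u l - C u (l - k *+ 2) = C u k - C u (- k).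
Proof.
rewrite /C -(sum_inv (fun a b => L a b u)) -(sum_inv2 (fun a b => L a b u) k l).
by rewrite -!sumrB; apply: eq_bigr => t _; rewrite cocycle_abcs.
Qed.

Lemma A_relation u k l : A u l - A (- u) (l - k *+ 2) = A u k - A (- u) (- k).
Proof.
rewrite /A -(sum_inv (fun a b => M a b (- u))).
rewrite -(sum_inv2 (fun a b => M a b (- u)) k l).
by rewrite -!sumrB; apply: eq_bigr => t _; rewrite cocycle_asde.
Qed.

Lemma C0 u : C u 0 = 0.
Proof. by rewrite /C big1 // => t _; rewrite addr0 /L /insert_last big1. Qed.

Lemma double_half k : (k * half) *+ 2 = k.
Proof. by rewrite -mulrnAr half2 mulr1. Qed.

Lemma sum_const (v : V) : \sum_(l : R) v = v *+ #|R|.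
Proof. by rewrite sumr_const. Qed.

(** With [k = h *+ 2], the relation at [l = k] gives [C u k = C u h - C u (- h)], and the sum of the
    relations over [l] kills [#|R|] times this. *)
Lemma C_torsion u k : C u k *+ #|R| = 0.
Proof.
pose h := k * half; have hk : h *+ 2 = k := double_half k.
have := C_relation u h k; rewrite hk subrr C0 subr0 => ->.
rewrite -sum_const -(eq_bigr _ (fun l _ => C_relation u h l)) sumrB.
by rewrite (sum_shift (C u)) subrr.
Qed.

(** Summing [A_relation] over its last argument shows that [#|R|] times [A u l - A (- u) (- l)] does
    not depend on [l]. With [k = h *+ 2], [A u k - A u 0] is the difference of its values at [h] and
    at [0]. *)
Lemma A_torsion u k : (A u k - A u 0) *+ #|R| = 0.
Proof.
have diff_torsion l : (A u l - A (- u) (- l)) *+ #|R| =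
    \sum_j A u j - \sum_j A (- u) j.
  rewrite -sum_const -(eq_bigr _ (fun j _ => A_relation u l j)) sumrB.
  by rewrite (sum_shift (A (- u))).
pose h := k * half; have hk : h *+ 2 = k := double_half k.
have := A_relation u h k; rewrite hk subrr => E.
have diff0 := diff_torsion 0; rewrite oppr0 in diff0.
rewrite -(subrKA (A (- u) 0)) E -(opprB (A u 0)) mulrnBl.
by rewrite diff_torsion diff0 subrr.
Qed.

(** Acting by [e] carries the left side to the right side. The terms [M _ e _] of the three
    relations cancel by the same pattern as in [special_cycle_coboundary3]. *)
Lemma special_cycleE e :
  special_cycle F = L (e *+ 2) (e *+ 2 - 1) (- 1) - M (e *+ 2) (e *+ 2) (- 1)
                    + M (e *+ 2 - 2) (e *+ 2 - 1) (- 1).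
Proof.
have := cocycle_abse 0 1 e 1; have := cocycle_asde 0 0 e 1.
have := cocycle_asde 2 1 e 1.
rewrite /inv mul0rn !subr0 subrr => E21 E00 E01.
have -> : special_cycle F = L 0 1 1 - M 0 0 1 + M 2 1 1 by [].
rewrite -(subrK (L (e *+ 2) (e *+ 2 - 1) (- 1)) (L 0 1 1)) -E01.
rewrite -(subrK (M (e *+ 2) (e *+ 2) (- 1)) (M 0 0 1)) -E00.
rewrite -(subrK (M (e *+ 2 - 2) (e *+ 2 - 1) (- 1)) (M 2 1 1)) -E21.
rewrite opprD opprB (addrACA (_ - M 2 e 1)) (addrACA (M 0 e 1 - M 2 e 1 + _))
  (addrC (_ - _) (_ - _)).
by rewrite !subrKA subrr add0r.
Qed.

Lemma special_cycle_torsion : special_cycle F *+ (#|R| * #|R|) = 0.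
Proof.
suff E : special_cycle F *+ #|R| = C (- 1) (- 1) + (A (- 1) 1 - A (- 1) 0).
  by rewrite mulrnA E mulrnDl C_torsion A_torsion addr0.
have double_inj : injective (fun e : R => e *+ 2).
  by move=> a b /(congr1 ( *%R^~ half)); rewrite !mulrnAl -!mulrnAr half2 !mulr1.
(* Add up [special_cycleE] over all [e]; since 2 is invertible, [t = e *+ 2] runs through [R]. *)
rewrite -sum_const (eq_bigr _ (fun e _ => special_cycleE e)).
rewrite -(reindex_inj (P := predT) (F := fun t => L t (t - 1) (- 1)
  - M t t (- 1) + M (t - 2) (t - 1) (- 1)) double_inj) /=.
rewrite !(sumrB, big_split) /= addrAC -addrA; congr (_ + _).
rewrite (sum_shift2 (fun a b => M a b (- 1))); congr (_ - _).
  by congr (A _ _); ring.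
by apply: eq_bigr => t _; rewrite addr0.
Qed.
End Torsion.
End DihedralSums.

(** * The 4-cocycle modulo [p] and its value on the special cycle *)

Section Cocycle.
Variable p : nat.
Hypotheses (p_prime : prime p) (p_odd : odd p).
Implicit Types a b c d e u v w x j : 'Z_p.

Let p_gt1 : (1 < p)%N := prime_gt1 p_prime.

(** It is 0 at 0 and [2r - p] at the class of [r] for [0 < r < p]: a lift of [a *+ 2] that is odd
    over the integers. *)
Definition odd_lift a : int := (nat_of_ord a)%:Z - (nat_of_ord (- a))%:Z.

Lemma odd_liftN a : odd_lift (- a) = - odd_lift a.
Proof. by rewrite /odd_lift opprK opprB. Qed.

Lemma odd_lift_mod a : (odd_lift a)%:~R = a *+ 2 :> 'Z_p.
Proof. by rewrite /odd_lift intrB -!pmulrn !natr_Zp opprK mulr2n. Qed.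

(** Minus the second difference of [odd_lift] at [b] with step [a]; it vanishes modulo [p], where
    [odd_lift] is linear. *)
Definition second_diff a b : int :=
  odd_lift b *+ 2 - odd_lift (a + b) - odd_lift (b - a).

Lemma intr_Zp_eq0 (n : int) : (n%:~R == 0 :> 'Z_p) = (p %| n)%Z.
Proof.
have natE m : (m%:R == 0 :> 'Z_p) = (p %| m)%N.
  by rewrite -val_eqE /= val_Zp_nat.
by case: n => n; rewrite ?NegzE ?intrN ?oppr_eq0 -pmulrn natE // dvdzN.
Qed.

(* Exact division, by [carryE]. *)
Definition carry a b : int := (second_diff a b %/ p)%Z.

Lemma carryE a b : carry a b * p = second_diff a b.
Proof.
apply: divzK; rewrite -intr_Zp_eq0 /second_diff 2!intrB mulr2n intrD !odd_lift_mod.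
by apply/eqP; ring.
Qed.

Lemma p_neq0 : (p%:Z != 0).
Proof. by rewrite eqz_nat -lt0n prime_gt0. Qed.

Lemma carry_inj (m n : int) : m * p = n * p -> m = n.
Proof. exact: (mulIf p_neq0). Qed.

Lemma carryNN a b : carry (- a) (- b) = - carry a b.
Proof.
apply: carry_inj; rewrite mulNr !carryE /second_diff -opprD opprK.
rewrite (_ : - b + a = - (b - a)) ?odd_liftN; first ring.
by rewrite opprB addrC.
Qed.

Lemma carry0l b : carry 0 b = 0.
Proof.
apply: carry_inj; rewrite mul0r carryE /second_diff add0r subr0 mulr2n.
by rewrite addrK subrr.
Qed.

Lemma carry0r a : carry a 0 = 0.
Proof.
apply: carry_inj; rewrite mul0r carryE /second_diff addr0 sub0r odd_liftN.
by rewrite {1}/odd_lift oppr0 subrr mul0rn sub0r subrr.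
Qed.

(** After multiplication by [p] the values of [odd_lift] cancel formally. *)
Lemma carry_cocycle a b c :
  carry b c *+ 2 - carry (a + b) c - carry (b - a) c
  + carry a (b + c) + carry (- a) (c - b) = 0.
Proof.
apply: carry_inj.
rewrite mul0r [carry b c *+ 2]mulr2n !mulrDl !mulNr !carryE /second_diff.
have -> : a + (b + c) = a + b + c by ring.
have -> : b + c - a = b - a + c by ring.
have -> : - a + (c - b) = c - (a + b) by ring.
have -> : c - b - - a = c - (b - a) by ring.
ring.
Qed.

Definition cocycle a b c d : 'Z_p := (a - b) * (carry (b - c) (c - d))%:~R.

Lemma cocycle_degenerate a b c d :
  [|| a == b, b == c | c == d] -> cocycle a b c d = 0.
Proof.
rewrite /cocycle => /or3P[]/eqP->; rewrite subrr ?mul0r //.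
  by rewrite carry0l mulr0.
by rewrite carry0r mulr0.
Qed.

Lemma coboundary4_cocycle a b c d e : coboundary4 cocycle a b c d e = 0.
Proof.
pose u := a - b; pose v := b - c; pose w := c - d; pose x := d - e.
(* The operation negates the difference of two entries it acts on. The faces at [e] cancel by
   [carryNN], and the rest is [u] times [carry_cocycle] at [(v, w, x)]. *)
transitivity (u * (carry w x *+ 2 - carry (v + w) x - carry (w - v) x
  + carry v (w + x) + carry (- v) (x - w))%:~R); last first.
  by rewrite carry_cocycle mulr0.
rewrite /coboundary4 /cocycle.
have -> : c *+ 2 - b - d = w - v by rewrite /w /v; ring.
have -> : b - d = v + w by rewrite /w /v; ring.
have -> : c - e = w + x by rewrite /w /x; ring.
have -> : d *+ 2 - b - (d *+ 2 - c) = - v by rewrite /v; ring.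
have -> : d *+ 2 - c - e = x - w by rewrite /x /w; ring.
have -> : e *+ 2 - b - (e *+ 2 - c) = - v by rewrite /v; ring.
have -> : e *+ 2 - c - (e *+ 2 - d) = - w by rewrite /w; ring.
rewrite carryNN -/v -/w -/x /u mulr2n !(intrD, intrB, intrN); ring.
Qed.

Lemma sum_odd_lift u : \sum_j odd_lift (j + u) = 0.
Proof.
rewrite sum_shift; have : \sum_j odd_lift j = - \sum_j odd_lift j.
  rewrite -[LHS](sum_reflect _ 0) -sumrN; apply: eq_bigr => j _.
  by rewrite sub0r odd_liftN.
by move: (\sum_j _) => s; lia.
Qed.

Lemma sum_odd_liftN u : \sum_j odd_lift (u - j) = 0.
Proof. by rewrite (sum_reflect odd_lift) -(sum_shift _ 0) sum_odd_lift. Qed.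

Lemma sum_const_Zp (n : int) : \sum_(j : 'Z_p) n = n * p.
Proof. by rewrite sumr_const card_ord Zp_cast // -mulr_natr natz. Qed.

(** Only the constant term of [second_diff] survives the sum; it occurs [p] times, which cancels the
    division by [p]. *)
Lemma sum_carry_l u b : \sum_j carry (u - j) b = odd_lift b *+ 2.
Proof.
apply: carry_inj; rewrite mulr_suml; under eq_bigr do rewrite carryE.
rewrite /second_diff 2!sumrB sum_const_Zp.
under [X in _ - X - _]eq_bigr do rewrite addrAC.
rewrite sum_odd_liftN; under [X in _ - X]eq_bigr do rewrite opprB addrCA.
by rewrite sum_odd_lift !subr0.
Qed.

Lemma sum_carry_r a u : \sum_j carry a (j + u) = 0.
Proof.
apply: carry_inj; rewrite mul0r mulr_suml; under eq_bigr do rewrite carryE.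
rewrite /second_diff 2!sumrB sumrMnl sum_odd_lift.
under [X in _ - X - _]eq_bigr do rewrite addrCA.
under [X in _ - X]eq_bigr do rewrite -addrA.
by rewrite !sum_odd_lift mul0rn !subr0.
Qed.

Lemma special_cycle_cocycle : special_cycle cocycle = 4%:R.
Proof.
pose g j : 'Z_p := (carry (- 1) (j + 1))%:~R.
rewrite /special_cycle /cocycle.
rewrite (eq_bigr (fun j => - (carry (1 - j) (- 1))%:~R)); last first.
  by move=> j _; rewrite sub0r mulN1r opprD addNKr.
rewrite [X in _ - X](eq_bigr (fun j => - j * g j)); last first.
  by move=> j _; rewrite opprD addNKr subr0 sub0r.
(* After this shift the last two sums share the factor [g j] and differ by the sum of [g], which is
   0. The first sum gives [- odd_lift (- 1) *+ 2], that is 4 modulo [p]. *)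
rewrite -[X in _ + X](sum_shift _ 1).
rewrite [X in _ + X](eq_bigr (fun j => (1 - j) * g j)); last first.
  move=> j _; rewrite addrK (_ : j + 1 - (j + 1 + 1) = - 1); last by ring.
  by congr (_ * _); ring.
rewrite -addrA (addrC (- _)) -sumrB.
rewrite [X in _ + X](eq_bigr g) => [|j _]; last by ring.
rewrite sumrN /g -!raddf_sum sum_carry_l sum_carry_r addr0 odd_liftN /=.
by rewrite mulNrn mulrNz opprK mulr2n intrD odd_lift_mod -!mulrnDr.
Qed.

Lemma special_cycle_cocycle_neq0 : special_cycle cocycle != 0.
Proof.
rewrite special_cycle_cocycle (intr_Zp_eq0 (2 ^ 2)%N) dvdzE /=.
rewrite Euclid_dvdX // andbT dvdn_prime2 //.
by apply: contraL p_odd => /eqP->.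
Qed.
End Cocycle.

(** * Classes in homology and naturality of the sums *)

Section HomologyClass.
Variables (A B C : zmodType) (f : {additive A -> B}) (g : {additive B -> C}).

(** Used with [n = 1] for nonvanishing and with [n = p * p] for torsion. *)
Lemma homology_class (b : B) : g b = 0 ->
  exists x : homology f g,
    forall n, x *+ n = 0 <-> exists a, b *+ n = f a.
Proof.
move=> gb; have bP : b \in cycle_pred g by apply/eqP.
pose z : cycles g := Sub b bP.
exists (\pi_(homology f g)%qT z) => n.
have vE : val (z *+ n) = b *+ n by rewrite raddfMn.
rewrite -raddfMn; split=> [/eqP|] H.
  by move: H; rewrite quot_pi_eq0 => /asboolP; rewrite vE.
by apply/eqP; rewrite quot_pi_eq0; apply/asboolP; rewrite vE.
Qed.
End HomologyClass.

Lemma freeg_additive_eq0 (K : choiceType) (V : zmodType)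
    (f : {additive {freeg K / int} -> V}) :
  (forall x, f << x >> = 0) -> forall c, f c = 0.
Proof.
move=> f0 c; rewrite -[c]freeg_sumE raddf_sum big1 // => x _.
by rewrite -[coeff _ _]intz -freegU_mulz raddfMz f0 mul0rz.
Qed.

Lemma special_cycle_raddf (R : finComNzRingType) (V W : zmodType)
    (f : {additive V -> W}) (F : R -> R -> R -> R -> V) :
  special_cycle (fun a b c d => f (F a b c d)) = f (special_cycle F).
Proof. by rewrite /special_cycle (raddfD f) (raddfB f) !(raddf_sum f). Qed.

Lemma coboundary4_raddf (R : finComNzRingType) (V W : zmodType)
    (f : {additive V -> W}) (F : R -> R -> R -> R -> V) a b c d e :
  coboundary4 (fun a b c d => f (F a b c d)) a b c d e =
  f (coboundary4 F a b c d e).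
Proof. by rewrite /coboundary4 !(raddfB f, raddfD f). Qed.

(** * The special class in the quandle homology of [dihedral p] *)

Section DihedralHomology.
Variable p : nat.
Hypotheses (p_prime : prime p) (p_odd : odd p).
Let X := dihedral p.

Definition rack_special_cycle : rack_chain X 4 :=
  special_cycle (R := 'Z_p) (@gen4 X).

Lemma rack_boundary_special_cycle : rack_boundary rack_special_cycle = 0.
Proof.
rewrite -special_cycle_raddf -(special_cycle_coboundary3 (R := 'Z_p) (@gen3 X)).
(* On [dihedral p], [qop] unfolds to the [inv] of [coboundary3]. *)
by congr special_cycle; do 4![apply: funext => ?]; exact: rack_boundary4.
Qed.

Definition special_class : quandle_chain X 4 :=
  \pi_(quandle_chain X 4)%qT rack_special_cycle.

Lemma quandle_boundary_special_class : quandle_boundary special_class = 0.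
Proof. by rewrite quandle_boundary_pi rack_boundary_special_cycle raddf0. Qed.

Lemma quandle_pi_degenerate n (x : n.-tuple X) :
  degenerate x -> \pi_(quandle_chain X n)%qT << x >> = 0.
Proof.
move=> xD; apply/eqP; rewrite quot_pi_eq0.
by apply: mem_generated; exists x.
Qed.

Lemma special_class_torsion :
  exists a, special_class *+ (p * p) = @quandle_boundary X 5 a.
Proof.
have p_gt1 := prime_gt1 p_prime.
pose V := cokernel (@quandle_boundary X 5).
(* With values in the cokernel of the boundary, the cocycle condition says exactly that boundaries
   of 5-tuples vanish. *)
pose F (a b c d : 'Z_p) : V :=
  \pi_V%qT (\pi_(quandle_chain X 4)%qT (@gen4 X a b c d)).
have F_cocycle a b c d e : coboundary4 F a b c d e = 0.
  rewrite coboundary4_raddf coboundary4_raddf.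
  apply/cokernel_pi_eq0; exists (\pi_(quandle_chain X 5)%qT (@gen5 X a b c d e)).
  apply/esym/(etrans (quandle_boundary_pi _)).
  by congr (\pi_(quandle_chain X 4)%qT _); exact: rack_boundary5.
have F_degenerate a c d : F a a c d = 0.
  rewrite /F /gen4 quandle_pi_degenerate ?raddf0 //.
  by apply: (@degenerateP X 4 _ 0 1).
(* As [p] is odd, [uphalf p] is [(p + 1) / 2], the inverse of 2. *)
have half2 : (uphalf p)%:R *+ 2 = 1 :> 'Z_p.
  rewrite -mulrnA muln2 (_ : _.*2 = p.+1)%N; last first.
    by rewrite -[RHS](odd_double_half p.+1) /= p_odd.
  by rewrite -natr1 pchar_Zp // add0r.
apply/cokernel_pi_eq0.
have := special_cycle_torsion F_cocycle F_degenerate half2.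
rewrite special_cycle_raddf special_cycle_raddf card_ord Zp_cast //.
by rewrite raddfMn.
Qed.

(* [zmodule] supplies the [int]-module structure that [fglift] requires. *)
Definition cocycle_tuple (x : 4.-tuple X) : (zmodule 'Z_p) :=
  cocycle (tnth x 0) (tnth x 1) (tnth x 2) (tnth x 3).

Definition evaluation : rack_chain X 4 -> (zmodule 'Z_p) := fglift cocycle_tuple.

HB.instance Definition _ := GRing.isZmodMorphism.Build
  (rack_chain X 4) (zmodule 'Z_p) evaluation (lift_is_additive cocycle_tuple).

Lemma evaluationE x : evaluation << x >> = cocycle_tuple x.
Proof. by rewrite /evaluation liftU scale1r. Qed.

Lemma evaluation_degenerate c : c \in @degenerate_chain X 4 -> evaluation c = 0.
Proof.
suff sub : {subset @degenerate_chain X 4 <= cycle_pred evaluation}.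
  by move=> /sub /eqP.
apply: generated_min => _ [x /existsP[i /existsP[j /andP[/eqP ji /eqP xji]]] ->].
apply/eqP/(etrans (evaluationE x))/cocycle_degenerate => //.
move: xji (ltn_ord j); rewrite !(tnth_nth (0 : 'Z_p)) ji.
by case: i {ji} => -[|[|[|//]]] /= _ ->; rewrite eqxx ?orbT.
Qed.

Lemma evaluation_gen4 :
  (fun a b c d => evaluation (@gen4 X a b c d)) = @cocycle p.
Proof. by do 4![apply: funext => ?]; exact: evaluationE. Qed.

Lemma evaluation_boundary5 (a b c d e : 'Z_p) :
  evaluation (rack_boundary (@gen5 X a b c d e)) = 0.
Proof.
rewrite (rack_boundary5 (X := X)).
apply: etrans (esym (coboundary4_raddf evaluation (@gen4 X) a b c d e)) _.
rewrite evaluation_gen4; exact: coboundary4_cocycle.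
Qed.

Lemma evaluation_boundary c : evaluation (@rack_boundary X 5 c) = 0.
Proof.
apply: (freeg_additive_eq0 (f := evaluation \o @rack_boundary X 5)) => x /=.
have -> : x = [tuple tnth x 0; tnth x 1; tnth x 2; tnth x 3; tnth x 4].
  by apply: val_inj; case: x => -[|a [|b [|c' [|d [|e []]]]]].
exact: evaluation_boundary5.
Qed.

(** Otherwise the rack cycle would be a rack boundary plus a degenerate chain. The evaluation kills
    both but is 4 on the cycle, nonzero modulo an odd prime. *)
Lemma special_class_neq_boundary a : special_class <> @quandle_boundary X 5 a.
Proof.
rewrite -[a]reprK quandle_boundary_pi => /eqP; rewrite -subr_eq0 -raddfB quot_pi_eq0.
move=> /evaluation_degenerate; rewrite raddfB => /eqP; rewrite subr_eq0.
move=> /eqP E; have := etrans E (evaluation_boundary _).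
rewrite -special_cycle_raddf evaluation_gen4.
by apply/eqP; exact: special_cycle_cocycle_neq0.
Qed.
End DihedralHomology.

Theorem theorem5p1 (p : nat) (p_prime : prime p) (p_odd : odd p) :
  has_subgroup_isomorphic_to 'Z_p (quandle_homology (dihedral p) 4).
Proof.
have [x xP] := homology_class (@quandle_boundary (dihedral p) 5)
  (@quandle_boundary_special_class p).
have x_neq0 : x != 0.
  apply/eqP => x0; have [a] := (xP 1%N).1 x0.
  exact: special_class_neq_boundary.
have [y y_neq0 yp0] :=
  torsion_element x_neq0 ((xP (p * p)%N).2 (special_class_torsion p_prime p_odd)).
exact: Zp_subgroup y_neq0 yp0.
Qed.
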